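(* Let $Z(t)$ be the solution of the stochastic differential equation $dZ(t)=\mu(Z(t))\,dt+\sigma(Z(t))\,dB_t$, $Z(0)=z$, where $B_t$ is standard Brownian motion and the coefficients $\mu,\sigma$ are regular enough that a unique strong solution exists. Suppose that $Z$ is conjugated to Brownian motion via the increasing function $v$, i.e. $v(0)=0$ and $Z(t)=v^{-1}(B_t+v(z))$ for all $t\ge 0$. Let $\tau_n(z)$, $n\ge1$, be the $n$-th passage time of $Z$ through the constant barrier $a$, and $T_n(z)=\tau_n(z)-\tau_{n-1}(z)$. Set $a'=v(a)$, $z'=v(z)$ and let $\tau_n^{B,a'}(z')$ be the $n$-th passage time through $a'$ of Brownian motion started from $z'$, namely of $z'+B_t$. Then for every $n\ge 1$, $$\tau_n(z)=\tau_n^{B,a'}(z')\quad\text{and}\quad T_n(z)=\tau_n^{B,a'}(z')-\tau_{n-1}^{B,a'}(z').$$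
   Context: The passage times are $\tau_1(z)=\inf\{t>0: Z(t)=a\}$, $\tau_n(z)=\inf\{t>\tau_{n-1}(z): Z(t)=a\}$ for $n\ge2$, and $\tau_1^{B,a'}(z')=\inf\{t>0: z'+B_t=a'\}$, $\tau_n^{B,a'}(z')=\inf\{t>\tau_{n-1}^{B,a'}(z'): z'+B_t=a'\}$ for $n\ge 2$, with $\tau_0(z)=\tau_0^{B,a'}(z')=0$ and $\inf\emptyset=+\infty$. Increasing means strictly increasing; $v$ is defined on an interval containing $0$, $a$ and the values of $Z$. The identity for $T_n(z)$ is understood where $\tau_{n-1}(z)<\infty$. *)

(* Defs.v *)
From HB Require Import structures.
From mathcomp Require Import all_boot all_order all_algebra.
From mathcomp Require Import all_classical all_reals all_analysis.

Set Implicit Arguments.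
Unset Strict Implicit.
Unset Printing Implicit Defensive.
Import Order.TTheory GRing.Theory Num.Theory.
Import numFieldNormedType.Exports.
Local Open Scope classical_set_scope.
Local Open Scope ring_scope.

(* Processes are functions X : R -> T -> R, first argument the time; only the
   values at times t >= 0 are ever constrained. *)

Section processes.
Context {R : realType} {d : measure_display} {T : measurableType d}.
Variable P : probability T R.
Implicit Types (B X H J : R -> T -> R) (F : R -> set (set T)).

Definition measurable_wrt (G : set (set T)) (f : T -> R) : Prop :=
  forall U : set R, measurable U -> G (f @^-1` U).

Definition adapted F X : Prop :=
  forall t : R, 0 <= t -> measurable_wrt (F t) (X t).

Definition past_events X (t : R) : set (set T) :=
  [set A | exists s, exists U : set R,
     [/\ 0 <= s, s <= t, measurable U & A = X s @^-1` U]].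

Definition natural_filtration X (t : R) : set (set T) :=
  <<s past_events X t >>.

(* The null events added are those of the sigma-algebra of T, so that the
   augmented sigma-algebras stay inside it; no completeness of P is needed. *)
Definition augmented_filtration X (t : R) : set (set T) :=
  <<s past_events X t `|` [set N | measurable N /\ P N = 0%E] >>.

Definition continuous_paths X : Prop :=
  {ae P, forall w, {within `[0, +oo[, continuous (X ^~ w)}}.

Definition increment X (s t : R) (w : T) : R := X t w - X s w.

(* normal_prob takes the standard deviation as second parameter. *)
Definition standard_brownian_motion B : Prop :=
  [/\ forall t : R, 0 <= t -> measurable_fun setT (B t),
      {ae P, forall w, B 0 w = 0},
      continuous_paths B,
      forall s t : R, 0 <= s -> s < t -> forall U : set R, measurable U ->
        P (increment B s t @^-1` U) = normal_prob 0 (Num.sqrt (t - s)) U &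
      forall s t : R, 0 <= s -> s < t -> forall (A : set T) (U : set R),
        natural_filtration B s A -> measurable U ->
        P (A `&` increment B s t @^-1` U)
        = (P A * P (increment B s t @^-1` U))%E].

(* Convergence to 0 in probability. The outer measure P^* agrees with P on
   events; it is used because the integrals over time to which this is applied
   need not be measurable in w when paths are only almost surely regular. *)
Definition cvg0_in_probability (X : nat -> T -> \bar R) : Prop :=
  forall e : R, 0 < e ->
    (P^* [set w | (e%:E <= X k w)%E])%mu @[k --> \oo] --> 0%E.

(* H_s = \sum_(i < n) xi_i 1_{]t_i, t_(i+1)]}(s) *)
Record simple_process := SimpleProcess {
  sp_size : nat ;
  sp_time : nat -> R ;
  sp_coef : nat -> T -> R }.

Definition simple_adapted F (S : simple_process) : Prop :=
  0 <= sp_time S 0 /\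
  forall i, (i < sp_size S)%N ->
    [/\ sp_time S i <= sp_time S i.+1,
        exists M : R, forall w, `|sp_coef S i w| <= M &
        measurable_wrt (F (sp_time S i)) (sp_coef S i)].

Definition simple_value (S : simple_process) (s : R) (w : T) : R :=
  \sum_(i < sp_size S)
    sp_coef S i w * \1_(`]sp_time S i, sp_time S i.+1]) s.

Definition simple_integral B (S : simple_process) (t : R) (w : T) : R :=
  \sum_(i < sp_size S)
    sp_coef S i w * (B (Num.min t (sp_time S i.+1)) w
                     - B (Num.min t (sp_time S i)) w).

(* J_t = \int_0^t H_s dB_s: J is the continuous adapted process whose values
   are the limits in probability of the integrals of simple adapted processes
   S_k such that \int_0^t (S_k - H)^2 ds tends to 0 in probability. It is
   unique up to indistinguishability when B is a Brownian motion for F. *)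
Definition is_ito_integral F B H J : Prop :=
  [/\ adapted F J, continuous_paths J &
      exists S : nat -> simple_process,
        (forall k, simple_adapted F (S k)) /\
        forall t : R, 0 <= t ->
          cvg0_in_probability (fun k w =>
            (\int[lebesgue_measure]_(s in `[0%R, t])
               ((simple_value (S k) s w - H s w) ^+ 2)%:E)%E) /\
          cvg0_in_probability (fun k w =>
            (`|simple_integral B (S k) t w - J t w|)%:E)].

Definition indistinguishable X X' : Prop :=
  {ae P, forall w, forall t : R, 0 <= t -> X t w = X' t w}.

(* Strong solution on the given space, for the given Brownian motion B, of
   dZ = mu(Z) dt + sigma(Z) dB, Z_0 = z. *)
Definition strong_solution (mu sigma : R -> R) (z : R) B (Z : R -> T -> R)
    : Prop :=
  let F := augmented_filtration B in
  [/\ adapted F Z,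
      continuous_paths Z,
      {ae P, forall w, Z 0 w = z},
      {ae P, forall w, forall t : R, 0 <= t ->
         (\int[lebesgue_measure]_(s in `[0%R, t])
            (`|mu (Z s w)| + sigma (Z s w) ^+ 2)%:E < +oo)%E} &
      exists J : R -> T -> R,
        is_ito_integral F B (fun s w => sigma (Z s w)) J /\
        {ae P, forall w, forall t : R, 0 <= t ->
           Z t w = z + (\int[lebesgue_measure]_(s in `[0, t]) mu (Z s w))
                   + J t w}].

Definition unique_strong_solution (mu sigma : R -> R) (z : R) B
    (Z : R -> T -> R) : Prop :=
  strong_solution mu sigma z B Z /\
  forall Z', strong_solution mu sigma z B Z' -> indistinguishable Z' Z.

(* Z(t) = v^{-1}(B_t + v(z)) on Omega0 for all t >= 0, where v^{-1} is the inverse,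
   defined on v(I), of the increasing function v : I -> R. The membership in
   v(I) says that the right-hand side is defined; pinv has a default value
   outside v(I). *)
Definition conjugated_to_BM (Omega0 : set T) (I : interval R) (v : R -> R) (z : R)
    B (Z : R -> T -> R) : Prop :=
  [/\ {in I &, {homo v : x y / x < y}},
      0 \in I, z \in I, v 0 = 0 &
      forall w, Omega0 w -> forall t : R, 0 <= t ->
        (v @` [set` I]) (B t w + v z) /\
        Z t w = pinv [set` I] v (B t w + v z)].

End processes.

(* n-th passage time of the path x through a; index 0 is the convention
   tau_0 = 0, and ereal_inf set0 = +oo. *)
Fixpoint passage_time {R : realType} (x : R -> R) (a : R) (n : nat) : \bar R :=
  match n with
  | 0 => 0%E
  | m.+1 => ereal_inf
      [set t%:E | t in [set t : R | (passage_time x a m < t%:E)%E /\ x t = a]]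
  end.

(* T_n = tau_n - tau_(n-1), for n >= 1; meaningful if tau_(n-1) < +oo. *)
Definition interpassage_time {R : realType} (x : R -> R) (a : R) (n : nat)
    : \bar R :=
  (passage_time x a n - passage_time x a n.-1)%E.

Definition started_at {R : realType} {T : Type} (z : R) (B : R -> T -> R)
    (t : R) (w : T) : R := z + B t w.

(* Main.v *)
Require Import Defs.
From HB Require Import structures.
From mathcomp Require Import all_boot all_order all_algebra.
From mathcomp Require Import all_classical all_reals all_analysis.
Import Order.TTheory GRing.Theory Num.Theory.
Import numFieldNormedType.Exports.
Local Open Scope classical_set_scope.
Local Open Scope ring_scope.

(** The argument is pathwise. For [w] in [Omega0], strict monotonicity makes [v] a bijection from I
    onto v(I), so Z(t) = a exactly when v(z) + B_t = v(a) ([conjugated_to_BM_hit]). Passage times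
    depend on a path only through its set of hitting times ([eq_passage_time]), so they agree for
    every n, and so do their differences. *)

Lemma passage_time_ge0 {R : realType} (x : R -> R) (a : R) (n : nat) :
  (0 <= passage_time x a n)%E.
Proof.
elim: n => [|n IHn] //=; apply/le_ereal_inf_tmp => _ [t [tn _] <-].
exact: le_trans IHn (ltW tn).
Qed.

(** Induction on n: the two infima range over the same set. Agreement at t > 0 suffices because a
    candidate t lies strictly above the previous passage time, which is nonnegative. *)
Lemma eq_passage_time {R : realType} (x y : R -> R) (a b : R) (n : nat) :
  (forall t, 0 < t -> x t = a <-> y t = b) ->
  passage_time x a n = passage_time y b n.
Proof.
move=> xy; elim: n => [|n IHn] //=; rewrite -IHn; congr (ereal_inf (_ @` _)).
apply/seteqP; split=> t /= [tn xt]; split=> //; apply/(xy t) => //;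
  rewrite -lte_fin; exact: le_lt_trans (passage_time_ge0 x a n) tn.
Qed.

Lemma conjugated_to_BM_hit {R : realType} {d : measure_display}
    {T : measurableType d}
    (Omega0 : set T) (I : interval R) (v : R -> R) (z a : R)
    (B Z : R -> T -> R) (w : T) (t : R) :
  conjugated_to_BM Omega0 I v z B Z -> a \in I -> Omega0 w -> 0 <= t ->
  Z t w = a <-> started_at (v z) B t w = v a.
Proof.
case=> v_incr _ _ _ vZ aI w0 t0; have [im_v ->] := vZ w w0 t t0.
have v_inj : {in [set` I] &, injective v}.
  move=> x y; rewrite !inE /= => xI yI vxy.
  case: (ltgtP x y) => // [/(v_incr x y xI yI)|/(v_incr y x yI xI)];
    by rewrite vxy ltxx.
rewrite /started_at [v z + _]addrC; split=> [<-|->].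
  (* Here v(v^{-1}(y)) = y for y = B_t + v(z); [im_v] puts y in v(I), away from the default value of
     [pinv]. *)
  by rewrite pinvK //; exact: mem_set.
(* Here v^{-1}(v(a)) = a, by injectivity of [v] on I and a in I. *)
by rewrite pinvKV //; exact: mem_set.
Qed.

Theorem mainTheorem4 (R : realType) (d : measure_display)
    (T : measurableType d) (P : probability T R)
    (B : R -> T -> R) (hB : standard_brownian_motion P B)
    (mu sigma : R -> R)
    (hmu : measurable_fun setT mu) (hsigma : measurable_fun setT sigma)
    (z : R) (Z : R -> T -> R)
    (hZ : unique_strong_solution P mu sigma z B Z)
    (I : interval R) (v : R -> R)
    (Omega0 : set T) (hW : P.-negligible (~` Omega0))
    (hv : conjugated_to_BM Omega0 I v z B Z)
    (a : R) (ha : a \in I) :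
  forall w, Omega0 w -> forall n : nat, (1 <= n)%N ->
    passage_time (Z ^~ w) a n
      = passage_time (started_at (v z) B ^~ w) (v a) n /\
    ((passage_time (Z ^~ w) a n.-1 < +oo)%E ->
     interpassage_time (Z ^~ w) a n
      = (passage_time (started_at (v z) B ^~ w) (v a) n
         - passage_time (started_at (v z) B ^~ w) (v a) n.-1)%E).
Proof.
move=> w w0.
have tauE n : passage_time (Z ^~ w) a n
    = passage_time (started_at (v z) B ^~ w) (v a) n.
  apply: eq_passage_time => t /ltW; exact: conjugated_to_BM_hit hv ha w0.
by move=> n _; split=> [|_]; rewrite ?/interpassage_time !tauE.
Qed.
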